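(* Let $H$ be a fully commutative heap of type $\widetilde{E}_6$ with more than five $t$-elements. Then the interval of $H$ between its extremal (i.e. smallest and largest) $t$-elements occurs as an interval in $\operatorname{Heap}(\mathbf w)$ with $$\mathbf w=\left((s_1ts_1's_1)(s_2ts_2's_2)(s_3ts_3's_3)\right)^N\quad\text{or}\quad \mathbf w=\left((s_1ts_1's_1)(s_3ts_3's_3)(s_2ts_2's_2)\right)^N$$ for a certain integer $N>0$.
   Context: The Coxeter graph $\widetilde{E}_6$ has vertices $t,s_1,s_2,s_3,s'_1,s'_2,s'_3$ with edges $\{t,s_j\}$ and $\{s_j,s'_j\}$ for $j=1,2,3$, all with $m=3$; non-adjacent vertices commute. An element of the Coxeter group is fully commutative (FC) if any of its reduced expressions can be obtained from any other one using only commutation relations. For a word $\mathbf w=x_1\cdots x_l$ in the generators, $\operatorname{Heap}(\mathbf w)$ is the poset on $\{1,\dots,l\}$ with order the transitive closure of $i\prec j$ for $i<j$ and $x_i,x_j$ equal or adjacent in the Coxeter graph, each $i$ being labeled $x_i$; heaps are considered up to label-preserving isomorphism. A heap is FC if it is $\operatorname{Heap}(\mathbf w)$ for a reduced word $\mathbf w$ of an FC element. A $t$-element is an element labeled $t$; the $t$-elements form a chain. The interval between $a\le b$ is $\{x:a\le x\le b\}$ with the induced order and labels. *)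

(* Defs.v *)
From HB Require Import structures.
From Stdlib Require Import Relations.
From mathcomp Require Import all_boot all_order.

Set Implicit Arguments.
Unset Strict Implicit.
Unset Printing Implicit Defensive.

Import Order.Theory.

(* A Coxeter matrix is a function m : S -> S -> nat; the value 0 stands for an
   infinite entry, so that the corresponding relator is the empty word.  The
   elements of the Coxeter group < S | (s t)^(m s t) = 1 > are represented by
   words over S, two words being identified when they are related by
   [same_element m].  As m s s = 1 makes every generator an involution, the
   monoid presentation below is that of the group. *)
Section CoxeterGroup.
Variables (S : finType) (m : S -> S -> nat).

Definition relator (s t : S) : seq S := flatten (nseq (m s t) [:: s; t]).

Inductive relator_step : seq S -> seq S -> Prop :=
  RelatorStep u v s t : relator_step (u ++ v) (u ++ relator s t ++ v).

Definition same_element : seq S -> seq S -> Prop :=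
  clos_refl_sym_trans (seq S) relator_step.

Definition reduced (w : seq S) : Prop :=
  forall u, same_element w u -> size w <= size u.

Inductive commutation_step : seq S -> seq S -> Prop :=
  CommutationStep u v s t of m s t = 2 :
    commutation_step (u ++ [:: s; t] ++ v) (u ++ [:: t; s] ++ v).

Definition commutation_equiv : seq S -> seq S -> Prop :=
  clos_refl_sym_trans (seq S) commutation_step.

(* The group element represented by w is fully commutative. *)
Definition fully_commutative (w : seq S) : Prop :=
  forall u v, same_element w u -> reduced u ->
              same_element w v -> reduced v -> commutation_equiv u v.

Definition adjacent (s t : S) : bool := (s != t) && (m s t != 2).

End CoxeterGroup.

(* Positions are numbered from 0.  'I_n already carries the usual total order,
   hence the alias. *)
Definition heap (S : finType) (m : S -> S -> nat) (w : seq S) : Type :=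
  'I_(size w).

HB.instance Definition _ (S : finType) (m : S -> S -> nat) (w : seq S) :=
  Finite.copy (heap m w) 'I_(size w).

Definition heap_label (S : finType) (m : S -> S -> nat) (w : seq S)
  (i : heap m w) : S := tnth (in_tuple w) i.

Section HeapOrder.
Variables (S : finType) (m : S -> S -> nat) (w : seq S).

Definition heap_rel : rel (heap m w) := fun i j =>
  (nat_of_ord i < nat_of_ord j) &&
  ((heap_label i == heap_label j) || adjacent m (heap_label i) (heap_label j)).

Definition heap_le : rel (heap m w) := connect heap_rel.

Lemma heap_le_leq (i j : heap m w) :
  heap_le i j -> nat_of_ord i <= nat_of_ord j.
Proof.
case/connectP=> p; elim: p i => [|k p IHp] i /=; first by move=> _ ->.
by case/andP=> /andP[/ltnW le_ik _] hp hj; apply: leq_trans le_ik (IHp k hp hj).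
Qed.

Lemma heap_le_refl : reflexive heap_le.
Proof. exact: connect0. Qed.

Lemma heap_le_anti : antisymmetric heap_le.
Proof.
move=> i j /andP[/heap_le_leq le_ij /heap_le_leq le_ji].
by apply: val_inj; apply/eqP; rewrite eqn_leq le_ij.
Qed.

Lemma heap_le_trans : transitive heap_le.
Proof. exact: connect_trans. Qed.

End HeapOrder.

Fact heap_display : Order.disp_t. Proof. exact: Order.Disp tt tt. Qed.

HB.instance Definition _ (S : finType) (m : S -> S -> nat) (w : seq S) :=
  Order.Le_isPOrder.Build heap_display (heap m w)
    (@heap_le_refl S m w) (@heap_le_anti S m w) (@heap_le_trans S m w).

Definition interval d (P : finPOrderType d) (a b : P) : Type :=
  {x : P | (a <= x <= b)%O}.

HB.instance Definition _ d (P : finPOrderType d) (a b : P) :=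
  SubFinite.copy (interval a b) {x : P | (a <= x <= b)%O}.

HB.instance Definition _ d (P : finPOrderType d) (a b : P) :=
  [SubChoice_isSubPOrder of interval a b by <: with d].

Definition interval_label d (P : finPOrderType d) (S : Type) (l : P -> S)
  (a b : P) (x : interval a b) : S := l (val x).

Definition labeled_iso d (P : finPOrderType d) d' (Q : finPOrderType d')
    (S : Type) (lP : P -> S) (lQ : Q -> S) : Prop :=
  exists f : P -> Q,
    [/\ bijective f, {mono f : x y / (x <= y)%O} & forall x, lQ (f x) = lP x].

(* The finite poset H labeled by l is, up to label-preserving isomorphism, the
   heap of a reduced word of a fully commutative element. *)
Definition fc_heap (S : finType) (m : S -> S -> nat)
    d (H : finPOrderType d) (l : H -> S) : Prop :=
  exists w : seq S,
    [/\ reduced m w, fully_commutative m w & labeled_iso l (@heap_label S m w)].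

Definition occurs_as_interval (S : Type)
    d (P : finPOrderType d) (lP : P -> S)
    d' (Q : finPOrderType d') (lQ : Q -> S) : Prop :=
  exists c e : Q, (c <= e)%O /\ labeled_iso lP (@interval_label d' Q S lQ c e).

Definition smallest_labeled (S : Type) (s : S)
    d (P : finPOrderType d) (l : P -> S) (a : P) : Prop :=
  l a = s /\ forall x, l x = s -> (a <= x)%O.

Definition largest_labeled (S : Type) (s : S)
    d (P : finPOrderType d) (l : P -> S) (b : P) : Prop :=
  l b = s /\ forall x, l x = s -> (x <= b)%O.

Inductive E6gen : Type := E6_t | E6_s1 | E6_s2 | E6_s3 | E6_s1' | E6_s2' | E6_s3'.

Definition E6gen_enum : seq E6gen := [:: E6_t; E6_s1; E6_s2; E6_s3; E6_s1'; E6_s2'; E6_s3'].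

Definition E6gen_index (x : E6gen) : nat :=
  match x with
  | E6_t => 0 | E6_s1 => 1 | E6_s2 => 2 | E6_s3 => 3 | E6_s1' => 4 | E6_s2' => 5 | E6_s3' => 6
  end.

Lemma E6gen_indexK : cancel E6gen_index (nth E6_t E6gen_enum).
Proof. by case. Qed.

HB.instance Definition _ := Countable.copy E6gen (can_type E6gen_indexK).

Lemma E6gen_enumP : Finite.axiom E6gen_enum.
Proof. by case. Qed.

HB.instance Definition _ := isFinite.Build E6gen E6gen_enumP.

Definition E6_edges : seq (E6gen * E6gen) :=
  [:: (E6_t, E6_s1); (E6_t, E6_s2); (E6_t, E6_s3); (E6_s1, E6_s1'); (E6_s2, E6_s2'); (E6_s3, E6_s3')].

Definition E6_matrix (x y : E6gen) : nat :=
  if x == y then 1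
  else if ((x, y) \in E6_edges) || ((y, x) \in E6_edges) then 3
  else 2.

Definition E6_word_123 (N : nat) : seq E6gen :=
  flatten (nseq N ([:: E6_s1; E6_t; E6_s1'; E6_s1] ++ [:: E6_s2; E6_t; E6_s2'; E6_s2]
                   ++ [:: E6_s3; E6_t; E6_s3'; E6_s3])).

Definition E6_word_132 (N : nat) : seq E6gen :=
  flatten (nseq N ([:: E6_s1; E6_t; E6_s1'; E6_s1] ++ [:: E6_s3; E6_t; E6_s3'; E6_s3]
                   ++ [:: E6_s2; E6_t; E6_s2'; E6_s2])).

(* Main.v *)
Require Import Defs.
From HB Require Import structures.
From Stdlib Require Import Relations.
From mathcomp Require Import all_boot all_order.
From mathcomp Require Import zify.

Set Implicit Arguments.
Unset Strict Implicit.
Unset Printing Implicit Defensive.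

Import Order.Theory.

(** In a simply laced type, two consecutive elements of a fully commutative
    heap with the same label s are separated by at least two elements whose
    labels are adjacent to s: otherwise commutations would bring the two letters
    s together, or to the two ends of a factor s r s, contradicting reducedness
    or full commutativity ([fc_adjacent_between], [fc_two_between]).

    In the affine diagram E6 call s_1, s_2, s_3 the arms and s'_j the outer
    neighbour of s_j.  The separation property has the following consequences.
    Two equal arms have a t between them and two equal outer elements have two
    equal arms between them.  So each gap between consecutive t-elements contains
    every arm at most once, and contains at least two arms.  If an arm is present
    in two consecutive gaps, its two occurrences are separated by only one t,
    hence also by an outer element; an arm present in three consecutive gaps
    would then give two outer elements with a single arm in between.  Thus among
    three consecutive gaps every arm is missing at least once, while each gap
    misses at most one arm: each gap misses exactly one arm, and the missing arms
    follow a cyclic order of period three ([gap_blocks]).  The outer s'_j of the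
    interval sit exactly between occurrences of s_j in consecutive gaps; with at
    least five t-elements any other position forces again two outer elements
    around a single arm ([outer_label]).

    The periodic words have the same description: up to a shift, their k-th
    block s t s' s contains the k-th t-element.  The number of t-elements below x
    and the label of x therefore tell to which letter of the periodic word x has
    to be sent ([slot]).  This map respects the order of any two elements with
    equal or adjacent labels, and such pairs generate the order of a heap, so it
    is an isomorphism between intervals ([interval_iso]). *)

(** * Reduced words of fully commutative elements *)

Section SimplyLacedWords.
Variables (S : finType) (m : S -> S -> nat).
Hypothesis m_diag : forall s, m s s = 1.
Hypothesis m_sym : forall s t, m s t = m t s.
Hypothesis m_laced : forall s t, adjacent m s t -> m s t = 3.

Let same := same_element m.

Lemma same_refl u : same u u. Proof. exact: rst_refl. Qed.

Lemma same_sym u v : same u v -> same v u. Proof. exact: rst_sym. Qed.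

Lemma same_trans v u w : same u v -> same v w -> same u w.
Proof. exact: rst_trans. Qed.

Lemma same_relator s t u v : same (u ++ relator m s t ++ v) (u ++ v).
Proof. by apply/same_sym/rst_step. Qed.

Lemma same_square s u v : same (u ++ s :: s :: v) (u ++ v).
Proof. by have := same_relator s s u v; rewrite /relator m_diag. Qed.

(** The relator of an involutive pair inserted in front of a factor leaves, after
    cancelling squares, the other side of the relation. *)
Lemma same_swap s t u v :
  m s t = 2 -> same (u ++ s :: t :: v) (u ++ t :: s :: v).
Proof.
rewrite m_sym => mts.
have := same_sym (same_relator t s u (s :: t :: v)).
rewrite /relator mts /= => /same_trans; apply.
have := same_square s (u ++ [:: t; s; t]) (t :: v).
rewrite -!catA /= => /same_trans; apply.
by have := same_square t (u ++ [:: t; s]) v; rewrite -!catA.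
Qed.

Lemma same_braid s t u v :
  m s t = 3 -> same (u ++ s :: t :: s :: v) (u ++ t :: s :: t :: v).
Proof.
rewrite m_sym => mts.
have := same_sym (same_relator t s u (s :: t :: s :: v)).
rewrite /relator mts /= => /same_trans; apply.
have := same_square s (u ++ [:: t; s; t; s; t]) (t :: s :: v).
rewrite -!catA /= => /same_trans; apply.
have := same_square t (u ++ [:: t; s; t; s]) (s :: v).
rewrite -!catA /= => /same_trans; apply.
by have := same_square s (u ++ [:: t; s; t]) v; rewrite -!catA.
Qed.

Lemma commutation_same u v : commutation_equiv m u v -> same u v.
Proof.
elim=> {u v} [_ _ [u v s t mst] | u | u v _ | u v w _ uv _ vw].
- exact: same_swap.
- exact: same_refl.
- exact: same_sym.
- exact: same_trans uv vw.
Qed.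

(** A braid move changes the number of occurrences of a letter, so this invariant
    tells braid moves apart from commutations. *)
Lemma commutation_perm u v : commutation_equiv m u v -> perm_eq u v.
Proof.
elim=> {u v} [_ _ [u v s t _] | u | u v _ | u v w _ uv _ vw] //.
- by rewrite perm_cat2l /= (perm_catCA [:: s] [:: t]).
- by rewrite perm_sym.
- exact: perm_trans uv vw.
Qed.

Lemma commutation_move s A B C :
  all (fun r => m s r == 2) B ->
  commutation_equiv m (A ++ s :: B ++ C) (A ++ B ++ s :: C).
Proof.
elim: B A => [|r B IH] A /=; first by move=> _; apply: rst_refl.
case/andP=> /eqP msr /IH {}IH; apply: rst_trans (rst_step _ _ _ _ _) _.
  exact: (CommutationStep A (B ++ C) msr).
by have := IH (rcons A r); rewrite !cat_rcons.
Qed.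

Lemma non_adjacent s r : r != s -> ~~ adjacent m s r -> m s r == 2.
Proof. by rewrite /adjacent eq_sym => -> /=; rewrite negbK. Qed.

(** With no letter of B adjacent to s the two letters s can be brought together
    and cancelled; with a single such letter r they can be brought around it, and
    a braid move on s r s produces a reduced word with one more r. *)
Lemma fc_adjacent_between w s A B C :
    reduced m w -> fully_commutative m w ->
    w = A ++ s :: B ++ s :: C -> s \notin B ->
  1 < count (adjacent m s) B.
Proof.
move=> red_w fc_w def_w sB; rewrite ltnNge; apply/negP=> leB1.
have commB B' : {subset B' <= B} -> ~~ has (adjacent m s) B' ->
    all (fun r => m s r == 2) B'.
  move=> sB'; rewrite -all_predC => /allP adjB'; apply/allP=> r rB'.
  apply: non_adjacent (adjB' r rB'); apply: contraNneq sB => <-; exact: sB'.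
case: (boolP (has (adjacent m s) B)) => [hasB | hasB]; last first.
  have := commutation_move A (s :: C) (commB B (fun _ => id) hasB).
  rewrite -def_w => /commutation_same same_w.
  have := red_w _ (same_trans same_w _); rewrite catA.
  move=> /(_ _ (same_square _ _ _)).
  by rewrite def_w !size_cat /= !size_cat /=; lia.
have [r [B1 [B2 [def_B adj_r hasB1]]]] : exists r B1 B2,
    [/\ B = B1 ++ r :: B2, adjacent m s r & ~~ has (adjacent m s) B1].
  case: (split_find hasB) => r B1 B2 adj_r hasB1.
  by exists r, B1, B2; rewrite cat_rcons.
have hasB2 : ~~ has (adjacent m s) B2.
  rewrite has_count -leqNgt; move: leB1.
  by rewrite def_B count_cat /= adj_r; lia.
have sub1 : {subset B1 <= B} by move=> x; rewrite def_B mem_cat => ->.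
have sub2 : {subset B2 <= B}.
  by move=> x xB2; rewrite def_B mem_cat inE xB2 !orbT.
have move1 := commutation_move A (r :: B2 ++ s :: C) (commB B1 sub1 hasB1).
have move2 := commutation_move (A ++ B1 ++ [:: s; r]) C (commB B2 sub2 hasB2).
have comm_w : commutation_equiv m w (A ++ B1 ++ s :: r :: s :: B2 ++ C).
  rewrite def_w def_B -!catA /=; apply: (rst_trans _ _ _ _ _ move1).
  by apply: rst_sym; move: move2; rewrite -!catA.
have := same_braid (A ++ B1) (B2 ++ C) (m_laced adj_r); rewrite -!catA => braid.
have same_w := same_trans (commutation_same comm_w) braid.
have red' : reduced m (A ++ B1 ++ r :: s :: r :: B2 ++ C).
  move=> u same_u; have := red_w u (same_trans same_w same_u).
  by rewrite def_w def_B; do !rewrite size_cat /=; lia.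
have := fc_w _ _ (same_refl w) red_w same_w red'.
move=> /commutation_perm /permP /(_ (pred1 r)).
have /negPf sNr : s != r by case/andP: adj_r.
rewrite def_w def_B; do !rewrite count_cat /=; rewrite sNr eqxx; lia.
Qed.

End SimplyLacedWords.

(** * Heaps as labeled posets *)

Definition linked (S : finType) (m : S -> S -> nat) : rel S :=
  fun s t => (s == t) || adjacent m s t.

(** The part of the structure of a heap that does not mention positions in a
    word: the order is generated by pairs with equal or adjacent labels.  The two
    generation axioms expose the ends of a saturated chain, which is how the
    transitive closure is used in inductions. *)
Record heap_poset (S : finType) (m : S -> S -> nat)
    d (P : finPOrderType d) (l : P -> S) : Prop := HeapPoset {
  linked_comparable : forall x y : P, linked m (l x) (l y) -> (x >=< y)%O;
  linked_first_step : forall x y : P, (x < y)%O ->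
    exists z, [/\ (x < z)%O, (z <= y)%O & linked m (l x) (l z)];
  linked_last_step : forall x y : P, (x < y)%O ->
    exists z, [/\ (x <= z)%O, (z < y)%O & linked m (l z) (l y)]
}.

(** The local form of full commutativity for simply laced types. *)
Definition two_between (S : finType) (m : S -> S -> nat)
    d (P : finPOrderType d) (l : P -> S) : Prop :=
  forall x y : P, (x < y)%O -> l x = l y ->
    (forall z, (x < z < y)%O -> l z <> l x) ->
  exists z1 z2, [/\ z1 != z2, (x < z1 < y)%O, (x < z2 < y)%O,
    adjacent m (l x) (l z1) & adjacent m (l x) (l z2)].

Section WordHeap.
Variables (S : finType) (m : S -> S -> nat) (w : seq S).
Hypothesis m_sym : forall s t, m s t = m t s.

Let pos (x : heap m w) : nat := nat_of_ord (x : 'I_(size w)).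

Lemma heap_le_pos (x y : heap m w) : (x <= y)%O -> pos x <= pos y.
Proof. exact: heap_le_leq. Qed.

Lemma heap_label_nth s0 (x : heap m w) : heap_label x = nth s0 w (pos x).
Proof. exact: tnth_nth. Qed.

Lemma linked_sym : symmetric (linked m).
Proof.
by move=> s t; rewrite /linked /adjacent eq_sym m_sym [t == s]eq_sym.
Qed.

Lemma heap_lt_linked (x y : heap m w) :
  pos x < pos y -> linked m (heap_label x) (heap_label y) -> (x < y)%O.
Proof.
move=> xy lxy; rewrite lt_def; apply/andP; split.
  by apply: contraTneq xy => ->; rewrite ltnn.
by apply: connect1; rewrite /heap_rel; apply/andP.
Qed.

Lemma heap_rel_lt (x y : heap m w) : heap_rel x y -> (x < y)%O.
Proof. by case/andP; apply: heap_lt_linked. Qed.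

(** The axioms read off the first and the last edge of a path of [heap_rel]. *)
Lemma word_heap_poset : heap_poset m (@heap_label S m w).
Proof.
split=> x y.
- move=> lxy; rewrite /Order.comparable; case: (ltngtP (pos x) (pos y)) => pxy.
  + by rewrite (ltW (heap_lt_linked pxy lxy)).
  + by rewrite linked_sym in lxy; rewrite (ltW (heap_lt_linked pxy lxy)) orbT.
  + by rewrite (_ : x = y) ?lexx //; apply: (@ord_inj (size w)).
- rewrite lt_neqAle => /andP[xNy /connectP[[|z p] /= path_p def_y]].
    by rewrite def_y eqxx in xNy.
  case/andP: path_p => xz zp; exists z; split; first exact: heap_rel_lt.
    by apply/connectP; exists p.
  by case/andP: xz.
- rewrite lt_neqAle => /andP[xNy /connectP[p path_p def_y]].
  elim/last_ind: p path_p def_y => [_ /= def_y | p z _].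
    by rewrite def_y eqxx in xNy.
  rewrite rcons_path last_rcons => /andP[path_p pz] ->.
  exists (last x p); split; last by case/andP: pz.
    by apply/connectP; exists p.
  exact: heap_rel_lt.
Qed.

Lemma two_nth_count (T : Type) (a : pred T) (s : seq T) x0 : 1 < count a s ->
  exists i j, [/\ i < j, j < size s, a (nth x0 s i) & a (nth x0 s j)].
Proof.
elim: s => //= y s IH; case: (boolP (a y)) => ay /=.
  rewrite add1n ltnS -has_count => has_s; exists 0, (find a s).+1.
  by split=> //=; [rewrite ltnS -has_find | apply: nth_find].
by rewrite add0n => /IH[i [j [ij js ai aj]]]; exists i.+1, j.+1.
Qed.

Hypothesis m_diag : forall s, m s s = 1.
Hypothesis m_laced : forall s t, adjacent m s t -> m s t = 3.

Lemma fc_two_between :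
  reduced m w -> fully_commutative m w -> two_between m (@heap_label S m w).
Proof.
move=> red_w fc_w x y xy lxy sep.
set s := heap_label x.
have pxy : pos x < pos y.
  rewrite ltn_neqAle heap_le_pos ?ltW // andbT.
  apply: contraTneq xy => pxy; rewrite (_ : x = y) ?ltxx //.
  exact: (@ord_inj (size w)).
pose n := pos y - (pos x).+1.
pose B := take n (drop (pos x).+1 w).
have yw : pos y < size w by apply: ltn_ord.
have sB : size B = n by rewrite size_takel // size_drop /n; lia.
have nthB i : i < n -> nth s B i = nth s w ((pos x).+1 + i).
  by move=> i_n; rewrite nth_take // nth_drop.
have inside i : i < n -> exists z : heap m w, pos z = (pos x).+1 + i.
  move=> i_n; have lt_w : (pos x).+1 + i < size w by lia.
  by exists (Ordinal lt_w).
have between (z : heap m w) : pos x < pos z < pos y ->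
    linked m s (heap_label z) -> (x < z < y)%O.
  case/andP=> xz zy sz; rewrite !heap_lt_linked // -lxy linked_sym; exact: sz.
have def_w : w = take (pos x) w ++ s :: B ++ s :: drop (pos y).+1 w.
  have nth_x : nth s w (pos x) = s by rewrite -heap_label_nth.
  have nth_y : nth s w (pos y) = s by rewrite -heap_label_nth -lxy.
  have def_y : s :: drop (pos y).+1 w = drop n (drop (pos x).+1 w).
    rewrite -{1}nth_y -drop_nth // drop_drop; congr (drop _ _).
    by rewrite /n; lia.
  rewrite def_y cat_take_drop -{1}nth_x -drop_nth ?cat_take_drop //.
  exact: ltn_trans pxy yw.
have sNB : s \notin B.
  apply/negP=> /(nthP s)[i]; rewrite sB => i_n.
  rewrite nthB //; have [z pz] := inside i i_n; rewrite -pz -heap_label_nth => lz.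
  by apply: (sep z) => //; apply: between; [rewrite pz; lia | rewrite lz /linked eqxx].
have := fc_adjacent_between m_diag m_sym m_laced red_w fc_w def_w sNB.
case/(two_nth_count s)=> i [j []]; rewrite sB => ij jn.
rewrite !nthB //; last exact: ltn_trans ij jn.
have [z1 pz1] := inside i (ltn_trans ij jn); have [z2 pz2] := inside j jn.
rewrite -pz1 -pz2 -!heap_label_nth => a1 a2; exists z1, z2; split=> //.
- by apply: contraTneq ij => def_z; move: pz1; rewrite def_z pz2; lia.
- by apply: between; [lia | rewrite /linked a1 orbT].
- by apply: between; [lia | rewrite /linked a2 orbT].
Qed.

End WordHeap.

Section Transfer.
Variables (S : finType) (m : S -> S -> nat).
Variables (d : Order.disp_t) (P : finPOrderType d) (lP : P -> S).
Variables (d' : Order.disp_t) (Q : finPOrderType d') (lQ : Q -> S).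
Hypothesis iso : labeled_iso lP lQ.

Lemma heap_poset_iso : heap_poset m lQ -> heap_poset m lP.
Proof.
case: iso => f [[g fK gK] f_mono lf] [cmp fst lst].
have f_lt := leW_mono f_mono; split=> x y.
- by rewrite -!lf => /cmp; rewrite /Order.comparable !f_mono.
- rewrite -f_lt => /fst[z [xz zy]]; rewrite !lf => lxz.
  by exists (g z); rewrite -f_lt -f_mono -[lP (g z)]lf gK; split.
- rewrite -f_lt => /lst[z [xz zy]]; rewrite !lf => lxz.
  by exists (g z); rewrite -f_lt -f_mono -[lP (g z)]lf gK; split.
Qed.

Lemma two_between_iso : two_between m lQ -> two_between m lP.
Proof.
case: iso => f [[g fK gK] f_mono lf] two x y.
have f_lt := leW_mono f_mono; rewrite -f_lt -!lf => xy lxy sep.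
case: (two (f x) (f y) xy lxy) => [z xzy lz | z1 [z2 [zN xz1 xz2 a1 a2]]].
  by apply: (sep (g z)); rewrite -?f_lt -?lf gK.
by exists (g z1), (g z2); rewrite (can_eq gK) -!f_lt -!lf !gK.
Qed.

End Transfer.

Lemma up_ind d (T : finPOrderType d) (K : T -> Prop) :
  (forall x, (forall y, (x < y)%O -> K y) -> K x) -> forall x, K x.
Proof.
move=> step x; have [n] := ubnP #|[pred y | (x < y)%O]|.
elim: n x => // n IH x lt_n; apply: step => y xy; apply: IH.
apply: leq_trans (proper_card _) lt_n; apply/properP; split.
  by apply/subsetP=> z; rewrite !inE; apply: lt_trans.
by exists y; rewrite !inE ?ltxx.
Qed.

Section IntervalIso.
Variables (S : finType) (m : S -> S -> nat).
Variables (d : Order.disp_t) (P : finPOrderType d) (lP : P -> S).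
Variables (d' : Order.disp_t) (Q : finPOrderType d') (lQ : Q -> S).
Hypothesis (hP : heap_poset m lP) (hQ : heap_poset m lQ).
Variables (a b : P) (f : P -> Q).
Let I : pred P := fun x => (a <= x <= b)%O.
Let J : pred Q := fun q => (f a <= q <= f b)%O.
Hypothesis f_label : forall x, I x -> lQ (f x) = lP x.
Hypothesis f_linked_lt : forall x y, I x -> I y ->
  linked m (lP x) (lP y) -> (x < y)%O -> (f x < f y)%O.
Hypothesis f_onto : forall q, J q -> exists2 x, I x & f x = q.

Lemma interval_convex x y z : I x -> I y -> (x <= z <= y)%O -> I z.
Proof.
move=> /andP[ax _] /andP[_ yb] /andP[xz zy].
by rewrite /I (le_trans ax) ?(le_trans zy).
Qed.

(** Generation of the order by linked pairs extends [f_linked_lt] to all pairs;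
    convexity keeps the generating chain inside the interval. *)
Lemma interval_homo_lt x y : I x -> I y -> (x < y)%O -> (f x < f y)%O.
Proof.
elim/up_ind: x => x IH Ix Iy xy.
have [z [xz zy lxz]] := linked_first_step hP xy.
have Iz : I z by apply: (interval_convex Ix Iy); rewrite ltW.
have fxz := f_linked_lt Ix Iz lxz xz.
move: zy; rewrite le_eqVlt => /orP[/eqP <- // | zy].
exact: lt_trans fxz (IH z xz Iz Iy zy).
Qed.

Lemma interval_homo_le x y : I x -> I y -> (x <= y)%O -> (f x <= f y)%O.
Proof.
move=> Ix Iy; rewrite !le_eqVlt => /orP[/eqP -> | xy]; first by rewrite eqxx.
by rewrite interval_homo_lt ?orbT.
Qed.

Lemma interval_linked_reflect x y : I x -> I y ->
  linked m (lP x) (lP y) -> (f x <= f y)%O -> (x <= y)%O.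
Proof.
move=> Ix Iy lxy fxy.
case/orP: (linked_comparable hP lxy) => //; rewrite le_eqVlt => /orP[/eqP -> // | yx].
by have := lt_le_trans (interval_homo_lt Iy Ix yx) fxy; rewrite ltxx.
Qed.

(** A chain of linked elements from f x to f y stays in the target interval, so
    by surjectivity it lifts, link by link, to a chain from x to y.  The
    induction runs over the image q of x, in the target. *)
Lemma interval_reflect q x y : f x = q -> I x -> I y -> (f x <= f y)%O -> (x <= y)%O.
Proof.
elim/up_ind: q x => q IH x def_q Ix Iy; rewrite le_eqVlt => /orP[/eqP fxy | fxy].
  apply: interval_linked_reflect => //; last by rewrite fxy.
  by rewrite -!f_label // fxy /linked eqxx.
have [r [xr ry lxr]] := linked_first_step hQ fxy.
have Jr : J r.
  case/andP: (Ix) => ax _; case/andP: (Iy) => _ yb.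
  have Ia : I a by rewrite /I lexx; case/andP: Ix => ? /(le_trans _)->.
  have Ib : I b by rewrite /I lexx andbT; case/andP: Ix => ? /(le_trans _)->.
  apply/andP; split; first exact: le_trans (interval_homo_le Ia Ix ax) (ltW xr).
  exact: le_trans ry (interval_homo_le Iy Ib yb).
have [z Iz def_r] := f_onto Jr.
rewrite -def_r in xr ry lxr; rewrite !f_label // in lxr.
have xz := interval_linked_reflect Ix Iz lxr (ltW xr).
by apply: le_trans xz _; apply: (IH (f z)) => //; rewrite -def_q.
Qed.

(** Injectivity of f is automatic: elements with the same image have the same
    label, hence are comparable. *)
Lemma interval_iso :
  labeled_iso (@interval_label d P S lP a b) (@interval_label d' Q S lQ (f a) (f b)).
Proof.
have Jf (x : interval a b) : J (f (val x)).
  have Ix : I (val x) := valP x; case/andP: (Ix) => ax xb.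
  have Ia : I a by rewrite /I lexx (le_trans ax).
  have Ib : I b by rewrite /I lexx andbT (le_trans ax).
  by apply/andP; split; apply: interval_homo_le.
pose F (x : interval a b) : interval (f a) (f b) := Sub (f (val x)) (Jf x).
have F_mono : {mono F : x y / (x <= y)%O}.
  move=> x y; rewrite -!Order.le_val !SubK; apply/idP/idP.
    exact: (interval_reflect (erefl _) (valP x) (valP y)).
  exact: (interval_homo_le (valP x) (valP y)).
have F_onto q : exists x, F x = q.
  have [x Ix def_q] := f_onto (valP q).
  by exists (Sub x Ix); apply: val_inj; rewrite !SubK.
have [G FG] := fin_all_exists F_onto.
exists F; split=> //; last by move=> x; apply: f_label (valP x).
exists G => // x; apply: (inc_inj F_mono); exact: FG.
Qed.

End IntervalIso.

(** * The diagram and the periodic sequence of arms *)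

Definition arm (s : E6gen) : bool :=
  match s with E6_s1 | E6_s2 | E6_s3 => true | _ => false end.

Definition outer (s : E6gen) : E6gen :=
  match s with E6_s1 => E6_s1' | E6_s2 => E6_s2' | E6_s3 => E6_s3' | _ => s end.

Lemma E6_matrix_diag s : E6_matrix s s = 1.
Proof. by rewrite /E6_matrix eqxx. Qed.

Lemma E6_matrix_sym s r : E6_matrix s r = E6_matrix r s.
Proof. by rewrite /E6_matrix eq_sym orbC. Qed.

Lemma E6_matrix_laced s r : adjacent E6_matrix s r -> E6_matrix s r = 3.
Proof. by case: s; case: r. Qed.

Lemma adjacent_t s : adjacent E6_matrix E6_t s = arm s.
Proof. by case: s. Qed.

Lemma adjacent_arm s r : arm s ->
  adjacent E6_matrix s r = (r == E6_t) || (r == outer s).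
Proof. by case: s; case: r. Qed.

Lemma adjacent_outer s r : arm s -> adjacent E6_matrix (outer s) r = (r == s).
Proof. by case: s; case: r. Qed.

Lemma outerN s r : arm s -> arm r -> (outer s == r) = false.
Proof. by case: s; case: r. Qed.

Lemma outer_inj s r : arm s -> arm r -> outer s = outer r -> s = r.
Proof. by case: s; case: r. Qed.

Variant E6gen_spec : E6gen -> Prop :=
  | E6gen_t : E6gen_spec E6_t
  | E6gen_arm s of arm s : E6gen_spec s
  | E6gen_outer s of arm s : E6gen_spec (outer s).

Lemma E6genP s : E6gen_spec s.
Proof.
case: s; try by constructor.
- exact: (@E6gen_outer E6_s1).
- exact: (@E6gen_outer E6_s2).
- exact: (@E6gen_outer E6_s3).
Qed.

(** The arm carried by the i-th block s t s' s of the periodic word, for the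
    cyclic order 1, 3, 2 if e holds and 1, 2, 3 otherwise. *)
Definition block (e : bool) (i : nat) : E6gen :=
  nth E6_t (if e then [:: E6_s1; E6_s3; E6_s2] else [:: E6_s1; E6_s2; E6_s3]) (i %% 3).

Lemma block_arm e i : arm (block e i).
Proof.
rewrite /block; have : i %% 3 < 3 by rewrite ltn_mod.
by case: e; case: (i %% 3) => [|[|[|]]].
Qed.

Lemma block3 e i : block e (i + 3) = block e i.
Proof. by rewrite /block modnDr. Qed.

(** Three consecutive values of [block] exhaust the arms. *)
Lemma block_missing e i s : arm s ->
  (s != block e i.+2) = (s == block e i) || (s == block e i.+1).
Proof.
rewrite /block -[i.+2]addn2 -[i.+1]addn1 -(modnDml i 1) -(modnDml i 2).
have : i %% 3 < 3 by rewrite ltn_mod.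
by case: e; case: (i %% 3) => [|[|[|]]] //= _; case: s.
Qed.

Lemma block_neq1 e i : block e i != block e i.+1.
Proof.
have := block_missing e i.+1 (block_arm e i).
by rewrite -[i.+3]addn3 block3 eqxx /= => /esym/norP[].
Qed.

Lemma block_neq2 e i : block e i != block e i.+2.
Proof. by rewrite block_missing ?block_arm // eqxx. Qed.

(** The combinatorics of gaps, on an abstract presence table: [g i s] stands for
    the presence of the arm s in the i-th gap, for 0 < i < K. *)
Section Gaps.
Variables (K : nat) (g : nat -> E6gen -> bool).
Hypothesis two : forall i, 0 < i < K -> exists s r,
  [/\ s != r, arm s, arm r, g i s & g i r].
Hypothesis not_three : forall i s, 0 < i -> i + 2 < K -> arm s ->
  ~~ [&& g i s, g i.+1 s & g i.+2 s].

Let maj i := [|| g i E6_s1 && g i E6_s2, g i E6_s2 && g i E6_s3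
                | g i E6_s3 && g i E6_s1].

Lemma gap_maj i : 0 < i < K -> maj i.
Proof.
move=> /two[s [r []]]; rewrite /maj.
by case: s => //; case: r => // _ _ _ -> ->; rewrite ?andbT ?orbT.
Qed.

(** Each of the four gaps misses at most one arm, and each arm is missing among
    both triples of consecutive gaps; the two gaps at the ends must then miss the
    only arm that is not missing from the two middle ones. *)
Lemma gap_period i s : 0 < i -> i + 3 < K -> arm s -> g (i + 3) s = g i s.
Proof.
move=> i0 iK; rewrite addn3.
have lt k : k <= 3 -> 0 < i + k < K by lia.
have := gap_maj (lt 0 isT); have := gap_maj (lt 1 isT).
have := gap_maj (lt 2 isT); have := gap_maj (lt 3 isT).
have i2 : i + 2 < K by lia.
have i3 : i.+1 + 2 < K by lia.
have i1 : 0 < i.+1 by [].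
move: (not_three i0 i2 (isT : arm E6_s1)) (not_three i0 i2 (isT : arm E6_s2)).
move: (not_three i0 i2 (isT : arm E6_s3)) (not_three i1 i3 (isT : arm E6_s1)).
move: (not_three i1 i3 (isT : arm E6_s2)) (not_three i1 i3 (isT : arm E6_s3)).
rewrite /maj addn0 addn1 addn2 addn3.
case: (g i.+1 E6_s1); case: (g i.+1 E6_s2); case: (g i.+1 E6_s3) => //;
case: (g i.+2 E6_s1); case: (g i.+2 E6_s2); case: (g i.+2 E6_s3) => //;
case: s => // ;
case: (g i E6_s1); case: (g i E6_s2); case: (g i E6_s3) => //;
case: (g i.+3 E6_s1); case: (g i.+3 E6_s2); case: (g i.+3 E6_s3) => //.
Qed.

(** The arms missing from the first three gaps are distinct; their order fixes e
    and the offset o, and [gap_period] propagates the pattern. *)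
Lemma gap_blocks : 3 < K -> exists e o, forall i s, 0 < i < K -> arm s ->
  g i s = (s != block e (i.+1 + o)).
Proof.
move=> K3.
suff [e [o go]] : exists e o, forall i s, 0 < i < 4 -> arm s ->
    g i s = (s != block e (i.+1 + o)).
  exists e, o => i; have [n] := ubnP i; elim: n i => // n IH i i_n s i0 arm_s.
  have [i4|i4] := ltnP i 4; first by apply: go => //; lia.
  rewrite -(subnK (ltnW i4)) gap_period //; [|lia..].
  rewrite IH //; [|lia..]; rewrite -addSn addnAC -(block3 e (_ + o)) //.
have M k : 0 < k < 4 -> maj k by move=> ?; apply: gap_maj; lia.
have N s := @not_three 1 s isT K3.
move: (M 1 isT) (M 2 isT) (M 3 isT) (N E6_s1 isT) (N E6_s2 isT) (N E6_s3 isT).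
rewrite /maj => {M N}.
pose P (b : E6gen -> bool) (r : E6gen) :=
  [/\ b E6_s1 = (E6_s1 != r), b E6_s2 = (E6_s2 != r) & b E6_s3 = (E6_s3 != r)].
move=> m1 m2 m3 n1 n2 n3.
suff [e [o [p1 p2 p3]]] : exists e o, [/\ P (g 1) (block e (2 + o)),
    P (g 2) (block e (3 + o)) & P (g 3) (block e (4 + o))].
  exists e, o => i s /andP[]; case: i => [|[|[|[|]]]] // _ _.
  - by case: p1; case: s.
  - by case: p2; case: s.
  - by case: p3; case: s.
rewrite /P; move: m1 m2 m3 n1 n2 n3.
case: (g 1 E6_s1); case: (g 1 E6_s2); case: (g 1 E6_s3) => //;
case: (g 2 E6_s1); case: (g 2 E6_s2); case: (g 2 E6_s3) => //;
case: (g 3 E6_s1); case: (g 3 E6_s2); case: (g 3 E6_s3) => //= _ _ _ _ _ _;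
  first [ by exists true, 0 | by exists true, 1 | by exists true, 2
        | by exists false, 0 | by exists false, 1 | by exists false, 2 ].
Qed.
End Gaps.

(** * Fully commutative heaps between t-elements *)

(** Order and label facts are irrelevant to the arithmetic of ranks, but slow
    down [lia] considerably when they are in the context. *)
Ltac nat_lia :=
  repeat match goal with
  | K := _ : nat |- _ => clearbody K
  | h : ?T |- _ =>
    lazymatch T with
    | is_true (leq _ _) => fail
    | is_true (leq _ _ && leq _ _) => fail
    | is_true (~~ (_ == _)) => fail
    | @eq nat _ _ => fail
    | _ => clear h
    end
  end; lia.

Section Rank.
Variables (d : Order.disp_t) (H : finPOrderType d) (l : H -> E6gen).
Hypotheses (heapH : heap_poset E6_matrix l) (twoH : two_between E6_matrix l).

Lemma linked_trichotomy x y : linked E6_matrix (l x) (l y) ->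
  [\/ (x < y)%O, x = y | (y < x)%O].
Proof.
move=> /(linked_comparable heapH) xy; case: (comparable_ltgtP xy);
  by [constructor 1 | constructor 2 | constructor 3].
Qed.

Lemma same_trichotomy x y : l x = l y -> [\/ (x < y)%O, x = y | (y < x)%O].
Proof. by move=> lxy; apply: linked_trichotomy; rewrite lxy /linked eqxx. Qed.

Lemma last_same x y : (x < y)%O -> l x = l y -> exists z,
  [/\ (x <= z)%O, (z < y)%O, l z = l y & forall u, (z < u < y)%O -> l u <> l z].
Proof.
elim/up_ind: x => x IH xy lxy.
case: (pickP [pred u | (x < u < y)%O && (l u == l x)]) => [u | sep].
  case/andP=> /andP[xu uy] /eqP lu.
  have [|z [uz zy lz sep]] := IH u xu uy; first by rewrite lu.
  by exists z; split=> //; apply: le_trans (ltW xu) uz.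
exists x; split=> // u xuy; move: (sep u); rewrite inE /= xuy /= => /eqP; exact.
Qed.

(** The two neighbours that separate consecutive outer elements can only be
    copies of the adjacent arm, since an outer generator has one neighbour. *)
Lemma arms_between_outers s u v : arm s -> l u = outer s -> l v = outer s ->
  (u < v)%O -> exists y1 y2,
  [/\ l y1 = s, l y2 = s, (u < y1)%O, (y1 < y2)%O & (y2 < v)%O].
Proof.
move=> arm_s lu lv uv.
have [|z [uz zv lz sep]] := last_same uv; first by rewrite lu.
have [|z1 [z2 []]] := twoH zv _ sep; first exact: lz.
rewrite lz lv !adjacent_outer // => zN /andP[zz1 z1v] /andP[zz2 z2v] /eqP l1 /eqP l2.
have [z12|z12|z12] : [\/ (z1 < z2)%O, z1 = z2 | (z2 < z1)%O].
- by apply: same_trichotomy; rewrite l1.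
- by exists z1, z2; rewrite (le_lt_trans uz zz1).
- by rewrite z12 eqxx in zN.
- by exists z2, z1; rewrite (le_lt_trans uz zz2).
Qed.

(** Without t, the two neighbours separating consecutive arms would be two outer
    elements with no arm in between. *)
Lemma t_between_arms s x y : arm s -> l x = s -> l y = s -> (x < y)%O ->
  exists z, [/\ l z = E6_t, (x < z)%O & (z < y)%O].
Proof.
move=> arm_s lx ly xy.
have [|z [xz zy lz sep]] := last_same xy; first by rewrite lx.
have [|z1 [z2 []]] := twoH zy _ sep; first exact: lz.
rewrite lz ly !adjacent_arm // => zN /andP[zz1 z1y] /andP[zz2 z2y].
case/orP=> /eqP l1; first by exists z1; rewrite (le_lt_trans xz zz1).
case/orP=> /eqP l2; first by exists z2; rewrite (le_lt_trans xz zz2).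
wlog z12 : z1 z2 zN zz1 z1y zz2 z2y l1 l2 / (z1 < z2)%O => [gen|].
  have [z12|z12|z12] : [\/ (z1 < z2)%O, z1 = z2 | (z2 < z1)%O].
  - by apply: same_trichotomy; rewrite l1.
  - exact: (gen z1 z2).
  - by rewrite z12 eqxx in zN.
  - by apply: (gen z2 z1); rewrite // eq_sym.
have [w [w' [lw _ z1w ww' w'z2]]] := arms_between_outers arm_s l1 l2 z12.
case: (sep w); last by rewrite lz ly.
by rewrite (lt_trans zz1) //= (lt_trans (lt_trans ww' w'z2)).
Qed.

(** The rank of a t-element is its index in the chain of t-elements.  An arm of
    rank i lies in the gap between the t-elements of rank i - 1 and i. *)
Definition rank (x : H) : nat := #|[set y | (l y == E6_t) && (y < x)%O]|.

Lemma rank_le x y : (x <= y)%O -> rank x <= rank y.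
Proof.
move=> xy; apply/subset_leq_card/subsetP=> z; rewrite !inE => /andP[-> /=].
by move/lt_le_trans; apply.
Qed.

Lemma rank_lt x y z : l z = E6_t -> (x <= z)%O -> (z < y)%O -> rank x < rank y.
Proof.
move=> lz xz zy; apply: proper_card; apply/properP; split.
  apply/subsetP=> u; rewrite !inE => /andP[-> /= ux].
  exact: lt_trans (lt_le_trans ux xz) zy.
exists z; rewrite !inE lz eqxx //=.
by apply/negP=> /lt_le_trans/(_ xz); rewrite ltxx.
Qed.

Lemma t_rank_lt x y : l x = E6_t -> (x < y)%O -> rank x < rank y.
Proof. by move=> lx; apply: rank_lt. Qed.

Lemma arm_rank_lt s x y : arm s -> l x = s -> l y = s -> (x < y)%O ->
  rank x < rank y.
Proof.
move=> arm_s lx ly /(t_between_arms arm_s lx ly)[z [lz xz zy]].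
exact: rank_lt lz (ltW xz) zy.
Qed.

Lemma lt_rank x y : linked E6_matrix (l x) (l y) -> rank x < rank y -> (x < y)%O.
Proof.
move=> lxy; case: (linked_trichotomy lxy) => [//|->|/ltW/rank_le]; first by rewrite ltnn.
by rewrite leqNgt => /negP.
Qed.

Lemma t_rank_inj x y : l x = E6_t -> l y = E6_t -> rank x = rank y -> x = y.
Proof.
move=> lx ly rxy; have : l x = l y by rewrite lx.
by case/same_trichotomy=> // [/(t_rank_lt lx) | /(t_rank_lt ly)]; rewrite rxy ltnn.
Qed.

Lemma arm_rank_inj s x y : arm s -> l x = s -> l y = s -> rank x = rank y -> x = y.
Proof.
move=> arm_s lx ly rxy; have : l x = l y by rewrite lx.
by case/same_trichotomy=> // [/(arm_rank_lt arm_s lx ly) | /(arm_rank_lt arm_s ly lx)];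
  rewrite rxy ltnn.
Qed.

Let K := #|[set x | l x == E6_t]|.

Lemma rank_max x : rank x <= K.
Proof. by apply/subset_leq_card/subsetP=> z; rewrite !inE => /andP[]. Qed.

Lemma t_rank_max x : l x = E6_t -> rank x < K.
Proof.
move=> lx; apply: proper_card; apply/properP; split.
  by apply/subsetP=> z; rewrite !inE => /andP[].
by exists x; rewrite !inE ?lx ?eqxx ?ltxx ?andbF.
Qed.

Lemma t_of_rank i : i < K -> exists x, l x = E6_t /\ rank x = i.
Proof.
move=> iK; pose ranks := [seq rank x | x <- enum [set x | l x == E6_t]].
have uniq_ranks : uniq ranks.
  rewrite map_inj_in_uniq ?enum_uniq // => x y; rewrite !mem_enum !inE.
  by move=> /eqP lx /eqP ly; apply: t_rank_inj.
have [||_ def_ranks] := uniq_min_size uniq_ranks (s2 := iota 0 K).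
- move=> j /mapP[x]; rewrite mem_enum inE => /eqP lx ->.
  by rewrite mem_iota /= add0n t_rank_max.
- by rewrite size_iota size_map -cardE.
have : i \in ranks by rewrite def_ranks mem_iota.
by case/mapP=> x; rewrite mem_enum inE => /eqP lx ->; exists x.
Qed.

(** Only one t-element separates arms of consecutive ranks, so the other of the
    two required neighbours is outer. *)
Lemma outer_between_arms s x y : arm s -> l x = s -> l y = s ->
  rank y = (rank x).+1 -> exists u, [/\ l u = outer s, (x < u)%O & (u < y)%O].
Proof.
move=> arm_s lx ly rxy.
have xy : (x < y)%O by apply: lt_rank; rewrite ?rxy // lx ly /linked eqxx.
have [||z1 [z2 []]] := twoH xy; first by rewrite lx.
  move=> z /andP[xz zy]; rewrite lx => lz.
  have := arm_rank_lt arm_s lx lz xz; have := arm_rank_lt arm_s lz ly zy; nat_lia.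
rewrite lx !adjacent_arm // => zN /andP[xz1 z1y] /andP[xz2 z2y].
case/orP=> /eqP l1; last by exists z1.
case/orP=> /eqP l2; last by exists z2.
case/eqP: zN; apply: t_rank_inj => //.
have := t_rank_lt l1 z1y; have := t_rank_lt l2 z2y.
have := rank_le (ltW xz1); have := rank_le (ltW xz2); nat_lia.
Qed.

Definition gap (i : nat) (s : E6gen) : bool :=
  [exists x, (l x == s) && (rank x == i)].

Lemma gapP i s : reflect (exists x, l x = s /\ rank x = i) (gap i s).
Proof.
apply: (iffP existsP) => [[x /andP[/eqP ? /eqP ?]] | [x [lx rx]]]; exists x => //.
by rewrite lx rx !eqxx.
Qed.

(** The arms of a gap are the neighbours that separate its two t-elements, and
    repeated arms would have a t between them. *)
Lemma gap_two i : 0 < i < K -> exists s r, [/\ s != r, arm s, arm r, gap i s & gap i r].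
Proof.
case: i => // i /= iK.
have [x [lx rx]] := t_of_rank (ltnW iK); have [y [ly ry]] := t_of_rank iK.
have lxy : l x = l y by rewrite lx.
have xy : (x < y)%O by apply: lt_rank; rewrite ?rx ?ry // lxy /linked eqxx.
have [|z1 [z2 []]] := twoH xy lxy.
  move=> z /andP[xz zy]; rewrite lx => lz.
  have := t_rank_lt lx xz; have := t_rank_lt lz zy; nat_lia.
rewrite lx !adjacent_t => zN /andP[xz1 z1y] /andP[xz2 z2y] a1 a2.
have r1 : rank z1 = i.+1.
  have := t_rank_lt lx xz1; have := rank_le (ltW z1y); nat_lia.
have r2 : rank z2 = i.+1.
  have := t_rank_lt lx xz2; have := rank_le (ltW z2y); nat_lia.
exists (l z1), (l z2); split=> //.
- apply: contra_neq zN => l12; apply: (arm_rank_inj a1) => //; last by rewrite r1.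
- by apply/gapP; exists z1.
- by apply/gapP; exists z2.
Qed.

(** Two outer elements, one on each side of the middle arm, would enclose no
    other arm. *)
Lemma gap_not_three i s : arm s -> ~~ [&& gap i s, gap i.+1 s & gap i.+2 s].
Proof.
move=> arm_s; apply/and3P=> -[/gapP[x [lx rx]] /gapP[y [ly ry]] /gapP[z [lz rz]]].
have [|u [lu xu uy]] := outer_between_arms arm_s lx ly; first by rewrite rx.
have [|v [lv yv vz]] := outer_between_arms arm_s ly lz; first by rewrite ry.
have [y1 [y2 [l1 l2 uy1 y12 y2v]]] := arms_between_outers arm_s lu lv (lt_trans uy yv).
have := arm_rank_lt arm_s lx l1 (lt_trans xu uy1).
have := arm_rank_lt arm_s l1 l2 y12.
have := arm_rank_lt arm_s l2 lz (lt_trans y2v vz); nat_lia.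
Qed.

Lemma arm_below_outer s u x : arm s -> l x = outer s -> l u <> outer s ->
  (u < x)%O -> exists z, [/\ l z = s, (u <= z)%O & (z < x)%O].
Proof.
move=> arm_s lx lu /(linked_last_step heapH)[z [uz zx]].
rewrite linked_sym; last exact: E6_matrix_sym.
rewrite /linked lx adjacent_outer // => /orP[/eqP lz | /eqP lz]; last by exists z.
have [y1 [y2 [_ l2 zy1 y12 y2x]]] := arms_between_outers arm_s (esym lz) lx zx.
exists y2; split=> //; exact: le_trans uz (ltW (lt_trans zy1 y12)).
Qed.

Lemma arm_above_outer s u x : arm s -> l x = outer s -> l u <> outer s ->
  (x < u)%O -> exists z, [/\ l z = s, (x < z)%O & (z <= u)%O].
Proof.
move=> arm_s lx lu /(linked_first_step heapH)[z [xz zu]].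
rewrite /linked lx adjacent_outer // => /orP[/eqP lz | /eqP lz]; last by exists z.
have [y1 [y2 [l1 _ xy1 y12 y2z]]] := arms_between_outers arm_s lx (esym lz) xz.
exists y1; split=> //; exact: le_trans (ltW (lt_trans y12 y2z)) zu.
Qed.

(** The t-elements below an outer element all lie below the last arm before it.
    This is what makes [rank] locate outer elements although they commute
    with t. *)
Lemma outer_rank s x : arm s -> l x = outer s -> 0 < rank x ->
  exists z, [/\ l z = s, (z < x)%O & rank z = rank x].
Proof.
move=> arm_s lx.
have below u : l u = E6_t -> (u < x)%O -> exists z, [/\ l z = s, (u <= z)%O & (z < x)%O].
  by move=> lu; apply: arm_below_outer => //; rewrite lu; case: (s) arm_s.
case/card_gt0P=> u0; rewrite inE => /andP[/eqP lu0 /(below _ lu0)[z0 [lz0 _ z0x]]].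
pose P := [pred z | (l z == s) && (z < x)%O].
have Pz0 : P z0 by rewrite /= lz0 eqxx.
case: (arg_maxnP rank Pz0) => z /andP[/eqP lz zx] z_max.
exists z; split=> //; apply/eqP; rewrite eqn_leq rank_le ?ltW //=.
apply/subset_leq_card/subsetP=> u; rewrite !inE => /andP[/eqP lu /(below _ lu)].
rewrite lu eqxx /= => -[y [ly uy yx]]; have /z_max /= le_yz : P y by rewrite /= ly eqxx.
have yz : (y <= z)%O.
  have : l z = l y by rewrite lz.
  case/same_trichotomy=> [/(arm_rank_lt arm_s lz ly) | -> // | /ltW //].
  by rewrite ltnNge le_yz.
rewrite lt_neqAle (le_trans uy yz) andbT; apply: contraTneq arm_s => uz.
by rewrite -lz -uz lu.
Qed.

Lemma outer_arm_rank_lt s x y : arm s -> l x = outer s -> l y = s ->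
  0 < rank x -> (x < y)%O -> rank x < rank y.
Proof.
move=> arm_s lx ly x0 xy; have [z [lz zx <-]] := outer_rank arm_s lx x0.
exact: arm_rank_lt arm_s lz ly (lt_trans zx xy).
Qed.

Lemma outer_rank_lt s x y : arm s -> l x = outer s -> l y = outer s ->
  0 < rank x -> (x < y)%O -> rank x < rank y.
Proof.
move=> arm_s lx ly x0 xy.
have [z [z' [lz _ xz zz' z'y]]] := arms_between_outers arm_s lx ly xy.
apply: leq_trans (outer_arm_rank_lt arm_s lx lz x0 xz) _.
exact: rank_le (ltW (lt_trans zz' z'y)).
Qed.

(** * Placing the interval in a periodic word *)

Section Slots.
Variables (e : bool) (o : nat) (a b : H).
Hypothesis K5 : 5 < K.
Hypothesis gapE : forall i s, 0 < i < K -> arm s ->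
  gap i s = (s != block e (i.+1 + o)).
Hypotheses (la : l a = E6_t) (lb : l b = E6_t).
Hypotheses (rank_a : rank a = 0) (rank_b : rank b = K.-1).

Let I : pred H := fun x => (a <= x <= b)%O.

Lemma t_inside x : l x = E6_t -> I x.
Proof.
move=> lx; apply/andP; split.
  have : l a = l x by rewrite la.
  case/same_trichotomy=> [/ltW // | -> // | /(t_rank_lt lx)]; by rewrite rank_a.
have : l x = l b by rewrite lb.
case/same_trichotomy=> [/ltW // | -> // | /(t_rank_lt lb)].
by have := t_rank_max lx; rewrite rank_b; nat_lia.
Qed.

Lemma linked_t s : arm s -> linked E6_matrix E6_t s.
Proof. by rewrite /linked adjacent_t orbC => ->. Qed.

Lemma linked_arm_t s : arm s -> linked E6_matrix s E6_t.
Proof. by move=> arm_s; rewrite linked_sym ?linked_t //; apply: E6_matrix_sym. Qed.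

Lemma arm_inside x : arm (l x) -> 0 < rank x < K -> I x.
Proof.
move=> arm_x /andP[x0 xK]; apply/andP; split.
  by apply/ltW/lt_rank; rewrite ?rank_a // la linked_t.
have : linked E6_matrix (l x) (l b) by rewrite lb linked_arm_t.
case/linked_trichotomy=> [/ltW // | -> // | /(t_rank_lt lb)].
by rewrite rank_b; nat_lia.
Qed.

Lemma inside_rank x : I x -> l x != E6_t -> 0 < rank x < K.
Proof.
case/andP=> ax xb lx; apply/andP; split.
  rewrite -rank_a; apply: t_rank_lt la _; rewrite lt_neqAle ax andbT.
  by apply: contra_neq lx => <-.
by have := rank_le xb; rewrite rank_b; nat_lia.
Qed.

(** An arm occurs in the block of the t-element above it or in the block of the
    t-element below it. *)
Lemma gap_arm x : arm (l x) -> I x ->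
  (l x == block e (rank x + o)) || (l x == block e ((rank x).-1 + o)).
Proof.
move=> arm_x Ix; have ltx : l x != E6_t by apply: contraTneq arm_x => ->.
have xK := inside_rank Ix ltx.
have : gap (rank x) (l x) by apply/gapP; exists x.
rewrite gapE //; case: (rank x) xK => // i _ /=; rewrite !addSn.
by rewrite block_missing // orbC.
Qed.

(** If s' lay between arms s that are not in consecutive gaps, then s would be
    missing from the gap after s' only, so that s occurs in the two gaps before
    that one, or in the two gaps after it.  Such a pair of occurrences encloses
    another s', and only one s separates the two outer elements.  The pair after
    the missing gap is used for an outer element of rank 1; it ends in the fourth
    gap, which exists because there are at least five t-elements. *)
Lemma outer_label s x : arm s -> l x = outer s -> I x ->
  s = block e (rank x + o).
Proof.
move=> arm_s lx Ix.
have ltx : l x != E6_t by rewrite lx; case: (s) arm_s.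
have lxN : E6_t <> outer s by case: (s) arm_s.
have /andP[x0 xK] := inside_rank Ix ltx.
have [z [lz zx rz]] := outer_rank arm_s lx x0.
have [y [ly xy yb]] : exists y, [/\ l y = s, (x < y)%O & (y <= b)%O].
  apply: arm_above_outer => //; first by rewrite lb.
  case/andP: Ix => _; rewrite le_eqVlt => /orP[/eqP xb|//].
  by rewrite xb lb eqxx in ltx.
have rxy := outer_arm_rank_lt arm_s lx ly x0 xy.
have ryK : rank y < K by have := rank_le yb; rewrite rank_b; nat_lia.
have gap_i : gap (rank x) s by apply/gapP; exists z.
move: gap_i; rewrite gapE ?x0 //.
case def_i: (rank x) => [|i]; first by rewrite def_i in x0.
rewrite !addSn block_missing // => /orP[/eqP si | /eqP //].
have siS : s != block e (i + o).+1 by rewrite si block_neq1.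
have siSS : s != block e (i + o).+2 by rewrite si block_neq2.
have skip v : l v = s -> rank v <> i.+2.
  move=> lv rv; have : gap i.+2 s by apply/gapP; exists v.
  rewrite gapE //; last by nat_lia.
  by rewrite !addSn -[_.+3]addn3 block3 -si eqxx.
(* s is absent from the gap after x *)
have ryi : i.+2 < rank y by have := skip y ly; nat_lia.
(* x has rank 1 in the first case, where there may be no s in an earlier gap *)
case: i => [|i] in def_i si siS siSS skip ryi *.
  have /gapP[y3 [l3 r3]] : gap 3 s.
    by rewrite gapE //; last nat_lia; rewrite !addSn -[_.+4]addn3 block3.
  have /gapP[y4 [l4 r4]] : gap 4 s.
    by rewrite gapE //; last nat_lia; rewrite !addSn -[_.+3.+2]addn3 block3.
  have [|u [lu y3u uy4]] := outer_between_arms arm_s l3 l4; first by rewrite r3.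
  have xu : (x < u)%O.
    apply: lt_rank; first by rewrite lx lu /linked eqxx.
    by have := rank_le (ltW y3u); nat_lia.
  have [y1 [y2 [l1 l2 xy1 y12 y2u]]] := arms_between_outers arm_s lx lu xu.
  have := outer_arm_rank_lt arm_s lx l1 x0 xy1.
  have := arm_rank_lt arm_s l1 l2 y12.
  have := arm_rank_lt arm_s l2 l4 (lt_trans y2u uy4).
  have := skip y1 l1; nat_lia.
have /gapP[z0 [l0 r0]] : gap i.+1 s by rewrite gapE //; nat_lia.
have [|u [lu z0u uz]] := outer_between_arms arm_s l0 lz; first by rewrite r0 rz.
have [y1 [y2 [l1 l2 uy1 y12 y2x]]] :=
  arms_between_outers arm_s lu lx (lt_trans uz zx).
have := arm_rank_lt arm_s l0 l1 (lt_trans z0u uy1).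
have := arm_rank_lt arm_s l1 l2 y12; have := rank_le (ltW y2x); nat_lia.
Qed.

Lemma outer_exists i : 0 < i -> i.+1 < K -> exists x,
  [/\ l x = outer (block e (i + o)), rank x = i & I x].
Proof.
move=> i0 iK; set s := block e (i + o); have arm_s : arm s by apply: block_arm.
have /gapP[y [ly ry]] : gap i s.
  by rewrite gapE //; [rewrite addSn block_neq1 | nat_lia].
have /gapP[z [lz rz]] : gap i.+1 s.
  by rewrite gapE // !addSn block_neq2.
have [|x [lx yx xz]] := outer_between_arms arm_s ly lz; first by rewrite ry.
have rx : rank x = i.
  have yx' := rank_le (ltW yx); apply/eqP; rewrite eqn_leq -{2}ry yx' andbT -ltnS.
  rewrite -rz; apply: (outer_arm_rank_lt arm_s lx lz _ xz); nat_lia.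
exists x; split=> //; have Iy : I y by apply: arm_inside; rewrite ?ly ?ry //; nat_lia.
have Iz : I z by apply: arm_inside; rewrite ?lz ?rz //; nat_lia.
by apply: (interval_convex Iy Iz); rewrite !ltW.
Qed.

(** The letter of the periodic word assigned to x.  The block s t s' s number i
    occupies the positions 4 * i, ..., 4 * i + 3 and its t is the t-element of
    rank i - o.  An arm of rank i - o is either the first letter of that block or
    the last letter of the preceding one. *)
Definition slot (x : H) : nat :=
  let i := rank x + o in
  if l x == E6_t then 4 * i + 1
  else if arm (l x) then (if l x == block e i then 4 * i else 4 * i - 1)
  else 4 * i + 2.

Lemma slot_t x : l x = E6_t -> slot x = 4 * (rank x + o) + 1.
Proof. by rewrite /slot => ->. Qed.

Lemma slot_outer s x : arm s -> l x = outer s -> slot x = 4 * (rank x + o) + 2.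
Proof. by rewrite /slot => + ->; case: s. Qed.

Lemma slot_arm x : arm (l x) -> slot x =
  if l x == block e (rank x + o) then 4 * (rank x + o) else 4 * (rank x + o) - 1.
Proof. by rewrite /slot; case: (l x). Qed.

Lemma slot_arm_bounds x : arm (l x) ->
  4 * (rank x + o) - 1 <= slot x <= 4 * (rank x + o).
Proof. by move=> arm_x; rewrite slot_arm //; case: ifP; nat_lia. Qed.

(** For linked labels the order is decided by ranks, except that an arm precedes
    the t and outer elements of its own rank. *)
Lemma slot_lt x y : I x -> I y -> linked E6_matrix (l x) (l y) ->
  (x < y)%O -> slot x < slot y.
Proof.
move=> Ix Iy lxy xy; have rxy := rank_le (ltW xy).
have rx := inside_rank Ix; have ry := inside_rank Iy.
have armNt s : arm s -> s != E6_t by case: s.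
have outerNt s : arm s -> outer s != E6_t by case: s.
case def_x: _ / (E6genP (l x)) => [|s arm_s|s arm_s].
- have rxy' := t_rank_lt def_x xy; rewrite slot_t //.
  case def_y: _ / (E6genP (l y)) => [|r arm_r|r arm_r].
  + by rewrite slot_t //; nat_lia.
  + by have := @slot_arm_bounds y; rewrite def_y => /(_ arm_r); nat_lia.
  + by rewrite (slot_outer arm_r def_y); nat_lia.
- have arm_x : arm (l x) by rewrite def_x.
  have := slot_arm_bounds arm_x.
  case def_y: _ / (E6genP (l y)) => [|r arm_r|r arm_r].
  + by rewrite [slot y]slot_t //; nat_lia.
  + have arm_y : arm (l y) by rewrite def_y.
    have := slot_arm_bounds arm_y; have : rank x < rank y; last by nat_lia.
    apply: (arm_rank_lt arm_s) => //; move: lxy.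
    rewrite def_x def_y /linked adjacent_arm //.
    by rewrite (negPf (armNt _ arm_r)) [r == outer s]eq_sym outerN // !orbF => /eqP.
  + by rewrite (slot_outer arm_r def_y); nat_lia.
- have /andP[rx0 _] : 0 < rank x < K by apply: rx; rewrite def_x outerNt.
  rewrite (slot_outer arm_s def_x); move: lxy; rewrite def_x /linked adjacent_outer //.
  case def_y: _ / (E6genP (l y)) => [|r arm_r|r arm_r].
  + by rewrite (negPf (outerNt _ arm_s)) eq_sym (negPf (armNt _ arm_s)).
  + rewrite outerN //= => /eqP rs; rewrite rs in def_y.
    have arm_y : arm (l y) by rewrite def_y.
    have := slot_arm_bounds arm_y.
    have := outer_arm_rank_lt arm_s def_x def_y rx0 xy; nat_lia.
  + rewrite [outer r == s]outerN // orbF => /eqP/(outer_inj arm_s arm_r) sr.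
    rewrite (slot_outer arm_r def_y); rewrite -sr in def_y.
    have := outer_rank_lt arm_s def_x def_y rx0 xy; nat_lia.
Qed.

(** The label of the letter at position p of the periodic word. *)
Definition slot_label (p : nat) : E6gen :=
  let s := block e (p %/ 4) in
  match p %% 4 with 1 => E6_t | 2 => outer s | _ => s end.

Lemma slot_labelE i r : r < 4 -> slot_label (4 * i + r) =
  match r with 1 => E6_t | 2 => outer (block e i) | _ => block e i end.
Proof.
by move=> r4; rewrite /slot_label mulnC modnMDl divnMDl // divn_small // addn0 modn_small.
Qed.

Lemma slot_label_slot x : I x -> slot_label (slot x) = l x.
Proof.
move=> Ix; case def_x: _ / (E6genP (l x)) => [|s arm_s|s arm_s].
- by rewrite slot_t // slot_labelE.
- have arm_x : arm (l x) by rewrite def_x.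
  have ltx : l x != E6_t by rewrite def_x; case: (s) arm_s.
  have := gap_arm arm_x Ix; have := inside_rank Ix ltx.
  rewrite slot_arm // def_x; case: eqP => /= [-> _ _|_].
    by rewrite -[4 * _]addn0 slot_labelE.
  case: (rank x) => //= i _ /eqP ->.
  by rewrite (_ : 4 * _ - 1 = 4 * (i + o) + 3) ?slot_labelE //; nat_lia.
- by rewrite (slot_outer arm_s def_x) slot_labelE // -(outer_label arm_s def_x Ix).
Qed.

Lemma arm_exists i s : 0 < i < K -> arm s -> s != block e (i.+1 + o) ->
  exists x, [/\ l x = s, rank x = i & I x].
Proof.
move=> iK arm_s; rewrite -gapE // => /gapP[x [lx rx]].
by exists x; split=> //; apply: arm_inside; rewrite ?lx ?rx.
Qed.

(** The position (slot a).+1 carries the outer letter of the block of a, which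
    commutes with t and is not above a. *)
Lemma slot_onto p : slot a <= p <= slot b -> p != (slot a).+1 ->
  exists2 x, I x & slot x = p.
Proof.
rewrite (divn_eq p 4); have : p %% 4 < 4 by rewrite ltn_mod.
rewrite !slot_t // rank_a rank_b; move: (p %/ 4) (p %% 4) => i r r4 ip pN.
have [k def_i] : exists k, i = k + o by exists (i - o); rewrite subnK; nat_lia.
subst i; have arm_k := block_arm e (k + o).
case: r r4 ip pN => [|[|[|[|r]]]] // _ ip pN.
- have [|//||x [lx rx Ix]] := @arm_exists k (block e (k + o)).
  + by nat_lia.
  + by rewrite addSn block_neq1.
  by exists x => //; rewrite slot_arm ?lx // rx eqxx; nat_lia.
- have [|x [lx rx]] := @t_of_rank k; first by nat_lia.
  by exists x; [apply: t_inside | rewrite slot_t // rx; nat_lia].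
- have [||x [lx rx Ix]] := @outer_exists k; [by nat_lia..|].
  by exists x => //; rewrite (slot_outer arm_k) // rx; nat_lia.
- have [|//||x [lx rx Ix]] := @arm_exists k.+1 (block e (k + o)).
  + by nat_lia.
  + by rewrite !addSn block_neq2.
  exists x => //; rewrite slot_arm ?lx // rx.
  by rewrite addSn (negPf (block_neq1 _ _)); nat_lia.
Qed.

End Slots.
End Rank.

Definition E6_word (e : bool) (N : nat) : seq E6gen :=
  if e then E6_word_132 N else E6_word_123 N.

Lemma size_E6_word e N : size (E6_word e N) = 12 * N.
Proof.
rewrite /E6_word /E6_word_132 /E6_word_123.
by case: e; elim: N => //= N ->; nat_lia.
Qed.

Lemma nth_E6_word e N p : p < 12 * N -> nth E6_t (E6_word e N) p = slot_label e p.
Proof.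
elim: N p => [|N IH] p; first by rewrite muln0.
move=> pN; have [p12|p12] := ltnP p 12.
  by rewrite /E6_word; case: e {IH}; do 12![case: p p12 pN => [//|p] p12 pN].
have -> : E6_word e N.+1 = E6_word e 1 ++ E6_word e N by case: e {IH}.
rewrite nth_cat size_E6_word ltnNge p12 /=.
rewrite IH; last by nat_lia.
have div12 q : (q + 12) %/ 4 = q %/ 4 + 3 by rewrite divnDr.
have mod12 q : (q + 12) %% 4 = q %% 4 by rewrite -modnDmr addn0.
by rewrite -{2}(subnK p12) /slot_label div12 mod12 block3.
Qed.

Theorem lemma5p3 (d : Order.disp_t) (H : finPOrderType d) (l : H -> E6gen)
    (hH : fc_heap E6_matrix l)
    (ht : 5 < #|[set x : H | l x == E6_t]|) :
  exists a b : H,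
    [/\ smallest_labeled E6_t l a,
        largest_labeled E6_t l b &
        exists2 N : nat, 0 < N &
          exists2 w : seq E6gen,
            w = E6_word_123 N \/ w = E6_word_132 N &
            occurs_as_interval (@interval_label d H E6gen l a b)
                               (@heap_label E6gen E6_matrix w)].
Proof.
case: hH => v [red_v fc_v iso_v].
have heapH := heap_poset_iso iso_v (word_heap_poset v E6_matrix_sym).
have twoH := two_between_iso iso_v
  (fc_two_between E6_matrix_sym E6_matrix_diag E6_matrix_laced red_v fc_v).
set K := #|_| in ht.
have [|a [la rank_a]] := t_of_rank heapH (i := 0); first by rewrite -/K; nat_lia.
have [|b [lb rank_b]] := t_of_rank heapH (i := K.-1); first by rewrite -/K; nat_lia.
have inside := t_inside heapH ht la lb rank_a rank_b.
exists a, b; split.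
- by split=> // x /inside/andP[].
- by split=> // x /inside/andP[].
have [||e [o gapE]] := @gap_blocks K (gap l) (gap_two heapH twoH).
- by move=> i s _ _; apply: gap_not_three.
- by nat_lia.
(* long enough to contain the slots of all elements of H *)
pose w := E6_word e (K + o).+1.
exists (K + o).+1 => //; exists w.
  by rewrite /w /E6_word; case: (e); [right | left].
have slot_w x : slot l e o x < size w.
  rewrite size_E6_word /slot; have : rank l x <= K by apply: rank_max.
  by case: ifP => _; [nat_lia | case: ifP => _; [case: ifP => _|]; nat_lia].
pose f (x : H) : heap E6_matrix w := Ordinal (slot_w x).
have heapW := word_heap_poset w E6_matrix_sym.
have f_label x : (a <= x <= b)%O -> heap_label (f x) = l x.
  move=> Ix; rewrite (heap_label_nth E6_t) nth_E6_word /=; last first.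
    by rewrite -(size_E6_word e).
  exact: (slot_label_slot heapH twoH ht gapE la lb rank_a rank_b).
have f_lt x y : (a <= x <= b)%O -> (a <= y <= b)%O ->
    linked E6_matrix (l x) (l y) -> (x < y)%O -> (f x < f y)%O.
  move=> Ix Iy lxy xy; apply: heap_lt_linked; last by rewrite !f_label.
  exact: (slot_lt heapH twoH e o ht la rank_a rank_b Ix Iy).
have f_onto q : (f a <= q <= f b)%O -> exists2 x, (a <= x <= b)%O & f x = q.
  case/andP=> aq qb.
  have sq : slot l e o a <= nat_of_ord q <= slot l e o b.
    by apply/andP; split; [apply: (heap_le_pos aq) | apply: (heap_le_pos qb)].
  have [|x Ix def_q] := slot_onto heapH twoH ht gapE la lb rank_a rank_b sq.
    apply/eqP=> pos_q.
    (* q would follow a immediately, so f a and q would be linked; but q is an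
       outer letter and a is labeled t *)
    have aqN : (f a < q)%O.
      rewrite lt_neqAle aq andbT; apply/eqP=> fa_q.
      by move: pos_q; rewrite -fa_q /=; nat_lia.
    have [z [az zq]] := linked_first_step heapW aqN.
    have -> : z = q.
      apply: (@ord_inj (size w)); apply/eqP; rewrite eqn_leq (heap_le_pos zq) pos_q.
      rewrite ltn_neqAle (heap_le_pos (ltW az)) andbT.
      apply: contraTneq az => az; rewrite (_ : z = f a) ?ltxx //.
      exact: (@ord_inj (size w)).
    have q_w : (slot l e o a).+1 < 12 * (K + o).+1.
      by rewrite -(size_E6_word e) -pos_q; apply: ltn_ord.
    rewrite f_label; last by have /andP[-> ->] := inside a la.
    rewrite la (heap_label_nth E6_t) pos_q nth_E6_word // slot_t // -addn1 -addnA.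
    rewrite slot_labelE // /linked adjacent_t.
    by have := block_arm e (rank l a + o); case: (block _ _).
  by exists x => //; apply: (@ord_inj (size w)).
exists (f a), (f b); split; last exact: (interval_iso heapH heapW f_label f_lt f_onto).
apply: (interval_homo_le heapH f_lt); [exact: inside | exact: inside |].
by have /andP[] := inside b lb.
Qed.
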